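(* Let $\alpha>0$ and $\beta>0$. The sharp (smallest possible) constant $K_1(\beta)$ in the inequality $$\|u\|_\infty^2\le K_1(\beta)\left(\int_0^{2\pi/\alpha}\bigl(u'(x)^2+\alpha^2\beta u(x)^2\bigr)dx\right)^{1/2}\left(\int_0^{2\pi/\alpha}u(x)^2dx\right)^{1/2}\quad\text{for all } u\in H^1(0,2\pi/\alpha)_{\mathrm{per}}$$ is given by $$K_1(\beta)=\sup_{\lambda>0}\sqrt{\lambda}\,\frac{\coth(\pi\sqrt{\beta+\lambda})}{\sqrt{\beta+\lambda}}.$$ Furthermore, for all $\beta\ge\beta_*=0.045\dots$, $K_1(\beta)=1$.
   Context: $H^1(0,2\pi/\alpha)_{\mathrm{per}}$ is the space of real-valued $2\pi/\alpha$-periodic functions in $H^1$ (no orthogonality to constants is assumed); $\|u\|_\infty$ is the sup norm. $\beta_*=0.045\dots$ is a constant found numerically, given by a decimal expansion beginning $0.045$, for which the supremum above (with $\beta=\beta_*$) is equal to $1$. *)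

(* Defs.v *)
From HB Require Import structures.
From mathcomp Require Import all_boot all_order all_algebra.
From mathcomp Require Import all_classical all_reals all_analysis.

Set Implicit Arguments.
Unset Strict Implicit.
Unset Printing Implicit Defensive.

Import Order.TTheory GRing.Theory Num.Theory.
Import numFieldNormedType.Exports.

Local Open Scope classical_set_scope.
Local Open Scope ring_scope.

Section PeriodicSobolev.
Context {R : realType}.
Implicit Types (T : R) (u v phi : R -> R).

Definition periodic_L2 T u : Prop :=
  [/\ periodic u T, measurable_fun setT u &
      (@lebesgue_measure R).-integrable `[0, T]%classic
        (fun x => ((u x) ^+ 2)%:E)].

Definition periodic_test T phi : Prop :=
  [/\ periodic phi T, forall x : R, derivable phi x 1 & continuous (derive1 phi)].

(* [v] is the weak derivative of [u] on the circle R / T Z: test functions are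
   periodic rather than compactly supported in ]0, T[, so that no jump of [u]
   at the end points is allowed. *)
Definition weak_derivative T u v : Prop :=
  forall phi, periodic_test T phi ->
    (\int[@lebesgue_measure R]_(x in `[0%R, T]) (u x * derive1 phi x))%R =
    - (\int[@lebesgue_measure R]_(x in `[0%R, T]) (v x * phi x))%R.

(* [u] belongs to H^1(0, T)_per and [v] is a version of u'. Functions are not
   quotiented by equality almost everywhere; everything below only depends on
   the class of [u] and of [v]. *)
Definition H1_per T u v : Prop :=
  [/\ periodic_L2 T u, periodic_L2 T v & weak_derivative T u v].

(* The L^oo norm over R, so that it is defined on classes; for a function in
   H^1 it is the supremum of |u| for the continuous representative. *)
Definition sup_norm u : \bar R :=
  ('N[@lebesgue_measure R]_(+oo)[EFin \o u])%E.

End PeriodicSobolev.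

Section SharpConstant.
Context {R : realType}.
Implicit Types (alpha beta K lambda : R).

Definition interpolation_inequality alpha beta K : Prop :=
  let T := 2 * pi / alpha in
  forall u v : R -> R, H1_per T u v ->
    ((sup_norm u) ^+ 2 <=
      (K
       * Num.sqrt (\int[@lebesgue_measure R]_(x in `[0%R, T])
                     ((v x) ^+ 2 + alpha ^+ 2 * beta * (u x) ^+ 2))%R
       * Num.sqrt (\int[@lebesgue_measure R]_(x in `[0%R, T])
                     ((u x) ^+ 2))%R)%:E)%E.

Definition is_sharp_constant alpha beta K : Prop :=
  interpolation_inequality alpha beta K /\
  forall K' : R, interpolation_inequality alpha beta K' -> K <= K'.

Definition coth (x : R) : R := (expR x + expR (- x)) / (expR x - expR (- x)).

Definition K1_values beta : set R :=
  [set Num.sqrt lambda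
       * (coth (pi * Num.sqrt (beta + lambda)) / Num.sqrt (beta + lambda))
  | lambda in [set l : R | 0 < l]].

(* "beta_* = 0.045...": the constant is only known through the beginning of its
   decimal expansion and through the value of the supremum. *)
Definition is_beta_star (b : R) : Prop :=
  45%:R / 1000%:R <= b < 46%:R / 1000%:R /\ sup (K1_values b) = 1.

End SharpConstant.

(* Main.v *)
Require Import Defs.
From HB Require Import structures.
From mathcomp Require Import all_boot all_order all_algebra.
From mathcomp Require Import ring lra.
From mathcomp Require Import all_classical all_reals all_analysis.
From mathcomp Require Import measurable_realfun ess_sup_inf.

Set Implicit Arguments.
Unset Strict Implicit.
Unset Printing Implicit Defensive.

Import Order.TTheory GRing.Theory Num.Theory.
Import numFieldNormedType.Exports.

Local Open Scope classical_set_scope.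
Local Open Scope ring_scope.

(** On a circle of length T = 2 pi / alpha, let g be the Green function of
    - D^2 + m^2 with m = alpha sqrt (beta + lambda); then
    max g = g(0) = coth (m T / 2) / (2 m).

    Upper bound.  For a continuous psi >= 0 put phi = g * psi.  Expanding
    int (v - s phi')^2 + m^2 (u - s phi)^2 >= 0 for all real s, with phi' as test
    function for the weak derivative v of u, gives
    |int u psi| <= sqrt (g(0) int (v^2 + m^2 u^2)) int psi.  Letting psi tend to
    indicators of arcs, this bounds the averages of u, hence u almost everywhere.
    Optimizing over lambda turns the sum
    int (v^2 + alpha^2 beta u^2) + alpha^2 lambda int u^2 into the product of the
    square roots.

    Sharpness.  u = g (up to scaling, cosh (m (x - T / 2)) on [0, T[) attains
    equality in the bound for a given lambda.

    Constant 1.  The values tend to 1 as lambda tends to infinity and decrease in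
    beta, and a value is at most 1 iff s^2 <= beta cosh^2 (pi s) at
    s = sqrt (beta + lambda).  The maximum of s^2 / cosh^2 (pi s) is 0.0445...,
    so that the supremum is 1 already at beta = 17 / 370 = 0.0459... *)

(** * Calculus on the real line *)

Section calculus.
Context {R : realType}.
Implicit Types (f g F : R -> R) (a b x y : R).
Notation mu := (@lebesgue_measure R).

Lemma continuous_integrable_itv f a b : continuous f ->
  mu.-integrable `[a, b] (EFin \o f).
Proof.
move=> cf; apply: continuous_compact_integrable; first exact: segment_compact.
by apply: continuous_subspaceT.
Qed.

Lemma derivable_continuous_all F f : (forall x, is_derive x 1 F (f x)) ->
  continuous F.
Proof.
move=> dF x; apply: differentiable_continuous.
by apply/derivable1_diffP; case: (dF x).
Qed.

Lemma Rintegral_derive f F a b : a < b -> continuous f ->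
  (forall x, is_derive x 1 F (f x)) ->
  \int[mu]_(x in `[a, b]) f x = F b - F a.
Proof.
move=> ab cf dF; rewrite /Rintegral (@continuous_FTC2 _ f F)//.
- exact: continuous_subspaceT.
- have cF := derivable_continuous_all dF; split.
  + by move=> x _; case: (dF x).
  + exact/cvg_at_right_filter/cF.
  + exact/cvg_at_left_filter/cF.
- by move=> x _; rewrite derive1E; apply: derive_val; exact: dF.
Qed.

Lemma is_derive_ge0_le F f a b : a <= b -> (forall x, is_derive x 1 F (f x)) ->
  (forall x, a <= x <= b -> 0 <= f x) -> F a <= F b.
Proof.
move=> ab dF f0.
have [|c cab e] := @MVT_segment R F f a b ab (fun x _ => dF x).
  exact/continuous_subspaceT/derivable_continuous_all.
by rewrite -subr_ge0 e mulr_ge0 ?subr_ge0// f0.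
Qed.

Lemma is_derive_eq0_cst F x y : (forall x, is_derive x 1 F 0) -> F x = F y.
Proof. by move=> dF; exact: is_derive_0_is_cst. Qed.

Lemma continuous_antiderivative f : continuous f ->
  exists F, forall x, is_derive x 1 F (f x).
Proof.
move=> cf.
(* An integral over an interval with reversed end points is 0, so this difference is the oriented
   integral from 0 to [x] for either sign of [x]. *)
exists (fun x => \int[mu]_(t in `[0, x]) f t - \int[mu]_(t in `[x, 0]) f t).
move=> x0; set F := (X in is_derive _ _ X _).
(* A base point to the left of both [x0] and 0: near [x0] the candidate is [G x - G 0], and the
   fundamental theorem of calculus applies to [G]. *)
pose a := Num.min x0 0 - 1.
have ax0 : a < x0 by rewrite /a ltrBlDr gt_min ltrDl ltr01.
have a0 : a < 0 by rewrite /a ltrBlDr gt_min ltrDl ltr01 orbT.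
pose G x := \int[mu]_(t in `[a, x]) f t.
have intf c d : mu.-integrable `[c, d] (EFin \o f).
  exact: continuous_integrable_itv.
have GB c d : a <= c -> c <= d -> G d - G c = \int[mu]_(t in `[c, d]) f t.
  move=> ac cd; rewrite /G Rintegral_itvB//.
  rewrite Rintegral_itv_obnd_cbnd//.
  by apply: integrableS (intf c d) => //; exact: subset_itv_oc_cc.
have int0 c d : d <= c -> \int[mu]_(t in `[c, d]) f t = 0.
  rewrite le_eqVlt => /predU1P[->|dc]; first by rewrite set_itv1 Rintegral_set1.
  by rewrite set_itv_ge ?Rintegral_set0// bnd_simp -ltNge.
have FE x : a < x -> F x = G x - G 0.
  move=> ax; rewrite /F; have [x_ge0|x_lt0] := leP 0 x.
    by rewrite GB ?(ltW a0)// (int0 x 0)// subr0.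
  by rewrite (int0 0 x) ?ltW// sub0r -[RHS]opprB GB// ltW.
have [dG G'] : derivable G x0 1 /\ derive1 G x0 = f x0.
  by apply: (@continuous_FTC1_closed _ f a x0 (x0 + 1)); rewrite ?ltrDl//; exact: cf.
have dG0 : is_derive x0 1 (fun x => G x - G 0) (f x0).
  have dGx : is_derive x0 1 G (f x0).
    by apply: DeriveDef; [exact: dG|rewrite -derive1E; exact: G'].
  have := is_deriveB dGx (is_derive_cst (G 0) x0 1); rewrite subr0; apply.
apply: near_eq_is_derive dG0.
by near=> x; rewrite -FE//; near: x; exact: lt_nbhsr.
Unshelve. all: by end_near. Qed.

Lemma is_derive_shift_arg f c x l : is_derive (x + c) 1 f l ->
  is_derive x 1 (fun y => f (y + c)) l.
Proof.
move=> df.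
have dg : is_derive x 1 (fun y : R => y + c) 1.
  have := is_deriveD (is_derive_id x (1 : R)) (is_derive_cst c x (1 : R)).
  by rewrite addr0; apply.
by have := @is_derive1_comp R f (fun y => y + c) x l 1 df dg; rewrite mulr1; apply.
Qed.

Lemma is_derive_subf f g x l k : is_derive x 1 f l -> is_derive x 1 g k ->
  is_derive x 1 (fun y => f y - g y) (l - k).
Proof. exact: is_deriveB. Qed.

Lemma is_derive_addf f g x l k : is_derive x 1 f l -> is_derive x 1 g k ->
  is_derive x 1 (fun y => f y + g y) (l + k).
Proof. exact: is_deriveD. Qed.

Lemma is_derive_mulf f g x l k : is_derive x 1 f l -> is_derive x 1 g k ->
  is_derive x 1 (fun y => f y * g y) (f x * k + g x * l).
Proof. exact: is_deriveM. Qed.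

Lemma is_derive_mull f (c x l : R) : is_derive x 1 f l ->
  is_derive x 1 (fun y => c * f y) (c * l).
Proof. exact: is_deriveZ. Qed.

Lemma is_derive_expR_mul (c x : R) :
  is_derive x 1 (fun y => expR (c * y)) (c * expR (c * x)).
Proof.
have dc : is_derive x 1 (fun y => c * y) (c * 1).
  exact: is_derive_mull (is_derive_id x (1 : R)).
by have := @is_derive1_comp R expR (fun y => c * y) x _ _
  (is_derive_expR (c * x)) dc;
  rewrite mulr1 mulrC; apply.
Qed.

End calculus.

(** * The periodic Green function *)

Section green.
Context {R : realType}.
Implicit Types (f g F psi : R -> R) (a b x y m T : R).
Notation mu := (@lebesgue_measure R).

(** [phi] is the convolution of [psi] with the periodic Green function, and the last clause replaces
    the kernel by its maximum. The equation is split into two first-order ones, with integrating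
    factors [ep] and [en]. *)
Lemma periodic_green_solution m T psi : 0 < m -> 0 < T ->
  continuous psi -> periodic psi T -> (forall x, 0 <= psi x) ->
  exists phi dphi : R -> R,
    [/\ periodic phi T, periodic dphi T,
        forall x, is_derive x 1 phi (dphi x),
        forall x, is_derive x 1 dphi (m ^+ 2 * phi x - psi x) &
        forall x, phi x <=
          coth (m * T / 2) / (2 * m) * \int[mu]_(t in `[0, T]) psi t].
Proof.
move=> m0 T0 cpsi ppsi psi0.
pose ep y := expR (m * y); pose en y := expR (- m * y); pose E := expR (m * T).
have dep x : is_derive x 1 ep (m * ep x) by exact: is_derive_expR_mul.
have den x : is_derive x 1 en (- m * en x) by exact: is_derive_expR_mul.
have ep0 y : ep y != 0 by rewrite gt_eqF ?expR_gt0.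
have enE y : en y = (ep y)^-1 by rewrite /en mulNr expRN.
have E1 : 1 < E by rewrite expR_gt1 mulr_gt0.
have E0 : E != 0 by rewrite gt_eqF ?expR_gt0.
have Em1 : E - 1 != 0 by rewrite gt_eqF// subr_gt0.
have mn0 : m != 0 by rewrite gt_eqF.
have epD y : ep (y + T) = ep y * E by rewrite /ep mulrDr expRD.
have epB y : ep (y - T) = ep y / E by rewrite /ep mulrBr expRB.
have ppsiB y : psi (y - T) = psi y by rewrite -[in RHS](subrK T y) ppsi.
have [|F dF] := @continuous_antiderivative R (fun t => ep t * psi t).
  by move=> x; apply: continuousM; [exact: (derivable_continuous_all dep)|exact: cpsi].
have [|H dH] := @continuous_antiderivative R (fun t => en t * psi t).
  by move=> x; apply: continuousM; [exact: (derivable_continuous_all den)|exact: cpsi].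
have [P dP] := continuous_antiderivative cpsi.
(* By periodicity of [psi], [F (y + T) - E * F y] has zero derivative; comparing its values at [x]
   and [x - T] gives the relation. *)
have FT x : F (x + T) - F x = E * (F x - F (x - T)).
  have := @is_derive_eq0_cst R (fun y => F (y + T) - E * F y) x (x - T).
  rewrite subrK => /(_ _)/wrap[z|].
    rewrite (_ : 0 = ep (z + T) * psi (z + T) - E * (ep z * psi z)).
      exact: (is_derive_subf (is_derive_shift_arg (dF _)) (is_derive_mull _ (dF _))).
    by rewrite ppsi epD; ring.
  by move=> /eqP; rewrite -subr_eq0 => /eqP K0; apply/eqP; rewrite -subr_eq0 -K0;
    apply/eqP; ring.
have HT x : H (x + T) - H x = E^-1 * (H x - H (x - T)).
  have := @is_derive_eq0_cst R (fun y => H (y + T) - E^-1 * H y) x (x - T).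
  rewrite subrK => /(_ _)/wrap[z|].
    rewrite (_ : 0 = en (z + T) * psi (z + T) - E^-1 * (en z * psi z)).
      exact: (is_derive_subf (is_derive_shift_arg (dH _)) (is_derive_mull _ (dH _))).
    by rewrite ppsi !enE epD; field; rewrite E0 ep0.
  by move=> /eqP; rewrite -subr_eq0 => /eqP K0; apply/eqP; rewrite -subr_eq0 -K0;
    apply/eqP; ring.
(* [c = 1 / (1 - exp (- m T))] sums a geometric series over all periods: [p x] is the integral of
   [exp (- m (x - t)) psi t] over all [t <= x], folded into one period, and [q] is its mirror
   image. *)
pose c := E / (E - 1).
(* - D^2 + m^2 = (m - D) (m + D): p + q solves the second-order equation up to
   the factor 2 m. *)
pose p x := c * (en x * (F x - F (x - T))).
pose q x := c * (ep x * (H (x + T) - H x)).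
have dp x : is_derive x 1 p (- m * p x + psi x).
  rewrite (_ : _ + _ = c * (en x * (ep x * psi x - ep (x - T) * psi (x - T)) +
      (F x - F (x - T)) * (- m * en x))).
    exact: (is_derive_mull _ (is_derive_mulf (den _)
      (is_derive_subf (dF _) (is_derive_shift_arg (dF _))))).
  by rewrite /p ppsiB epB enE /c; field; rewrite ep0 E0 Em1.
have dq x : is_derive x 1 q (m * q x - psi x).
  rewrite (_ : _ - _ = c * (ep x * (en (x + T) * psi (x + T) - en x * psi x) +
      (H (x + T) - H x) * (m * ep x))).
    exact: (is_derive_mull _ (is_derive_mulf (dep _)
      (is_derive_subf (is_derive_shift_arg (dH _)) (dH _)))).
  by rewrite /q ppsi !enE epD /c; field; rewrite ep0 E0 Em1.
have pp : periodic p T.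
  by move=> x; rewrite /p addrK FT !enE epD; field; rewrite ep0 E0.
have pq : periodic q T.
  by move=> x; rewrite /q HT addrK epD; field.
exists (fun x => (2 * m)^-1 * (p x + q x)), (fun x => 2^-1 * (q x - p x)).
split.
- by move=> x; rewrite pp pq.
- by move=> x; rewrite pp pq.
- move=> x; rewrite (_ : 2^-1 * _ =
    (2 * m)^-1 * (- m * p x + psi x + (m * q x - psi x))).
    exact: (is_derive_mull _ (is_derive_addf (dp _) (dq _))).
  by field.
- move=> x; rewrite (_ : _ - _ = 2^-1 * (m * q x - psi x - (- m * p x + psi x))).
    exact: (is_derive_mull _ (is_derive_subf (dq _) (dp _))).
  by field.
move=> x; rewrite (Rintegral_derive T0 cpsi dP).
(* The mass of [psi] is moved to the period from [x - T] to [x], on which the kernel seen from [x]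
   has a single formula. *)
have PT : P T - P 0 = P x - P (x - T).
  have := @is_derive_eq0_cst R (fun y => P (y + T) - P y) 0 (x - T).
  rewrite add0r subrK; apply => z.
  rewrite (_ : 0 = psi (z + T) - psi z); last by rewrite ppsi subrr.
  exact: (is_derive_subf (is_derive_shift_arg (dP _)) (dP _)).
pose h := expR (m * T / 2).
have h0 : h != 0 by rewrite gt_eqF ?expR_gt0.
have Eh : E = h ^+ 2 by rewrite /E /h -expRM_natl; congr expR; field.
have kE : coth (m * T / 2) = (E + 1) / (E - 1).
  rewrite /coth expRN -/h.
  have h1 : h ^+ 2 - 1 != 0 by rewrite -Eh.
  by rewrite Eh; field; rewrite h0 /= ?h1 //.
set k := coth _ in kE *.
rewrite PT mulrAC mulrC ler_pM2r ?invr_gt0 ?mulr_gt0//.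
(* [D x - D (x - T)] is [k] times the mass of [psi] minus [p x + q x], so it suffices that [D] is
   nondecreasing on this period. *)
pose D y := k * P y - c * en x * F y - c * (ep x / E) * H y.
have dD y : is_derive y 1 D (k * psi y - c * en x * (ep y * psi y) -
    c * (ep x / E) * (en y * psi y)).
  exact: (is_derive_subf (is_derive_subf (is_derive_mull _ (dP _))
    (is_derive_mull _ (dF _))) (is_derive_mull _ (dH _))).
have : D (x - T) <= D x.
  apply: (is_derive_ge0_le _ dD); first by rewrite gerBl ltW.
  move=> y /andP[xTy yx].
  (* with z = exp (m (x - y)) in [1, E] this is (z - 1) (E / z - 1) >= 0 *)
  pose z := expR (m * (x - y)).
  have zE : ep x = z * ep y by rewrite /z mulrBr expRB divfK//; exact: ep0.
  have z1 : 1 <= z by rewrite -expR0 ler_expR mulr_ge0 ?subr_ge0// ltW.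
  have zE' : z <= E.
    by rewrite ler_expR ler_pM2l// lerBlDr -lerBlDl.
  have z0 : z != 0 by rewrite gt_eqF ?expR_gt0.
  rewrite !enE zE kE /c.
  rewrite (_ : _ - _ = psi y * ((z - 1) * (E - z) / (z * (E - 1)))); last first.
    by field; rewrite ?ep0 ?Em1 ?z0 ?E0.
  by rewrite mulr_ge0 ?psi0// divr_ge0// mulr_ge0 ?subr_ge0 ?expR_ge0// ltW.
rewrite /D /p /q HT => D0; rewrite -subr_ge0; rewrite -subr_ge0 in D0.
by apply: le_trans D0 _; rewrite le_eqVlt; apply/orP; left; apply/eqP; field.
Qed.

End green.

(** * Periodic negligible sets *)

Section translation.
Context {R : realType}.
Implicit Types (T c : R) (A : set R).
Notation mu := (@lebesgue_measure R).

Lemma preimage_translation_itv c (a b : R) :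
  (fun x => x + c) @^-1` `]a, b] = `](a - c), (b - c)]%classic.
Proof.
by apply/seteqP; split=> x /=; rewrite !in_itv/= ltrBlDr lerBrDr.
Qed.

(** The pushforward by a translation agrees with the Lebesgue measure on half-open intervals, which
    determine it. *)
Lemma lebesgue_measure_translation c A : measurable A ->
  mu ((fun x => x + c) @^-1` A) = mu A.
Proof.
move=> mA; pose f (x : measurableTypeR R) : measurableTypeR R := x + c.
have mf : measurable_fun [set: measurableTypeR R] f.
  by apply: measurable_realfun.measurable_funD.
apply/esym/(@lebesgue_measure_unique R
  (measure_function_pushforward__canonical__measure_function_Measure mu mf)) => //.
move=> X /ocitvP[->|[[a b] /= ab ->]]; first by rewrite !measure0.
rewrite [RHS]/pushforward preimage_translation_itv !lebesgue_measure_itv/= !lte_fin.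
by rewrite ltrD2r ab -!EFinB opprB addrA subrK.
Qed.

(** [A] is covered by countably many translates of its part in one period, one family of translates
    for each direction. *)
Lemma periodic_negligible T A : 0 < T -> measurable A ->
  (forall x, A x -> A (x + T)) -> (forall x, A x -> A (x - T)) ->
  mu (A `&` `[0, T[) = 0 -> mu.-negligible A.
Proof.
move=> T0 mA AD AB A0.
pose B := A `&` `[0, T[%classic.
have mB : measurable B by apply: measurableI.
have nB c : mu.-negligible ((fun x => x + c) @^-1` B).
  have mBc : measurable ((fun x => x + c) @^-1` B).
    rewrite -[X in measurable X]setTI.
    by apply: measurable_realfun.measurable_funD.
  by apply/negligibleP => //; rewrite -A0; exact: lebesgue_measure_translation.
have AnD n x : A x -> A (x + n%:R * T).
  move=> Ax; elim: n => [|n ih]; first by rewrite mul0r addr0.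
  by rewrite -natr1 mulrDl mul1r addrA; exact: AD.
have AnB n x : A x -> A (x - n%:R * T).
  move=> Ax; elim: n => [|n ih]; first by rewrite mul0r subr0.
  by rewrite -natr1 mulrDl mul1r opprD addrA; exact: AB.
have : mu.-negligible
    ((\bigcup_n ((fun x => x + n%:R * T) @^-1` B)) `|`
     (\bigcup_n ((fun x => x - n%:R * T) @^-1` B))).
  by apply: negligibleU; apply: negligible_bigcup => n; exact: nB.
apply: negligibleS.
move=> x Ax.
have := floor_itv (x / T).
rewrite ler_pdivlMr// ltr_pdivrMr//.
case: (Num.floor (x / T)) => n /andP[lx xu].
- right; exists n => //=; split; first exact: AnB.
  rewrite intrD1 mulrDl mul1r in xu.
  by rewrite /= in_itv/= subr_ge0 lx ltrBlDl.
(* Here the floor is [Negz n], that is [- (n + 1)], hence the index [n.+1]. *)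
- left; exists n.+1 => //=; split; first exact: AnD.
  move: lx xu; rewrite NegzE intrD mulrDl !mulrNz !mulNr mul1r => lx xu.
  by rewrite /= in_itv/= -lerBlDr sub0r lx addrC -ltrBrDl addrC.
Qed.

End translation.

(** * From periodic test functions to almost everywhere bounds *)

Section duality.
Context {R : realType}.
Implicit Types (h psi : R -> R) (a b r x y alpha : R).
Notation mu := (@lebesgue_measure R).

(** Past [pi] the cosine is reflected by [t -> 2 * pi - t]; it stays at most [cos r] up to
    [2 * pi - r]. Superlevel sets of the cosine thus describe arcs of the circle. *)
Lemma ltr_cos_arc (r t : R) : 0 <= r <= pi -> 0 <= t <= 2 * pi - r ->
  (cos r < cos t) = (t < r).
Proof.
move=> /andP[r0 rpi] /andP[t0 tr]; have [tpi|pit] := leP t pi.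
  by rewrite ltr_cos// in_itv/= ?r0 ?t0.
have -> : cos t = cos (2 * pi - t).
  by rewrite addrC mulr_natl cosD2pi cosN.
rewrite ltr_cos ?in_itv/= ?r0 ?rpi//.
  by rewrite !ltNge; congr negb; apply/idP/idP => _; lra.
by apply/andP; split; lra.
Qed.

(** Continuous approximation, from below, of the indicator of the arc of centre [x] and half-length
    [r]; going through the cosine makes it periodic at once. *)
Definition arc_bump alpha x r (n : nat) y : R :=
  Num.min 1 (Num.max 0 (n%:R * (cos (alpha * (y - x)) - cos (alpha * r)))).

Lemma arc_bump_ge0 alpha x r n y : 0 <= arc_bump alpha x r n y.
Proof. by rewrite le_min ler01 le_max lexx. Qed.

Lemma arc_bump_le1 alpha x r n y : arc_bump alpha x r n y <= 1.
Proof. by rewrite ge_min lexx. Qed.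

Lemma arc_bump_periodic alpha x r n : alpha != 0 ->
  periodic (arc_bump alpha x r n) (2 * pi / alpha).
Proof.
move=> a0 y; rewrite /arc_bump.
have -> : alpha * (y + 2 * pi / alpha - x) = alpha * (y - x) + pi *+ 2.
  by rewrite -mulr_natl; field.
by rewrite cosD2pi.
Qed.

Lemma continuous_arc_bump alpha x r n : continuous (arc_bump alpha x r n).
Proof.
pose g y := n%:R * (cos (alpha * (y - x)) - cos (alpha * r)).
have cg : continuous g.
  move=> y; apply: cvgM; first exact: cvg_cst.
  apply: cvgB; last exact: cvg_cst.
  apply: (@continuous_comp _ _ _ (fun y => alpha * (y - x)) cos); last first.
    exact: continuous_cos.
  apply: cvgM; first exact: cvg_cst.
  by apply: cvgB; [exact: cvg_id|exact: cvg_cst].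
move=> y; have c0 : {for y, continuous (cst 0 \max g)}.
  by apply: continuous_max; [exact: cst_continuous|exact: cg].
have : {for y, continuous (cst 1 \min (cst 0 \max g))}.
  by apply: continuous_min; [exact: cst_continuous|exact: c0].
by apply.
Qed.

Lemma cvg_arc_bump alpha x r y :
  arc_bump alpha x r n y @[n --> \oo] -->
    ((cos (alpha * r) < cos (alpha * (y - x)))%R%:R : R).
Proof.
rewrite /arc_bump; set c := cos _ - cos _.
have -> : (cos (alpha * r) < cos (alpha * (y - x))) = (0 < c) by rewrite subr_gt0.
have [c0|c0] := ltP 0 c; apply: cvg_near_cst.
  near=> n; apply/min_idPl; rewrite le_max; apply/orP; right.
  rewrite -ler_pdivrMr//; near: n; exact: nbhs_infty_ger.
apply: nearW => n; rewrite (max_idPl _) ?mulr_ge0_le0//.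
by rewrite minElt ltr10.
Unshelve. all: by end_near. Qed.

(** The arc bumps converge pointwise to the indicator of []a, b[], and their products with [h] are
    dominated by the absolute value of [h]. *)
Lemma Rintegral_ge0_of_periodic alpha h a b :
  let T := 2 * pi / alpha in
  0 < alpha -> mu.-integrable `[0, T] (EFin \o h) ->
  (forall psi, continuous psi -> periodic psi T -> (forall x, 0 <= psi x) ->
    0 <= \int[mu]_(x in `[0, T]) (h x * psi x)) ->
  0 <= a -> a <= b -> b <= T -> 0 <= \int[mu]_(x in `[a, b]) h x.
Proof.
move=> T al0 ih hpsi a0 ab bT.
pose x := (a + b) / 2; pose r := (b - a) / 2.
have aT : alpha * T = 2 * pi by rewrite /T mulrC divfK// gt_eqF.
(* For [y] in [[0, T]] the distance to the centre is at most [T - r], so that no other periodic copy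
   of the arc is met. *)
have arcE y : y \in `[0, T] ->
    (cos (alpha * r) < cos (alpha * (y - x))) = (y \in `]a, b[).
  rewrite !in_itv/= => /andP[y0 yT].
  have -> : cos (alpha * (y - x)) = cos (alpha * `|y - x|).
    by rewrite -[in RHS](gtr0_norm al0) -normrM cos_norm.
  rewrite ltr_cos_arc.
  - rewrite ltr_pM2l// ltr_distl /x /r.
    by congr (_ && _); [apply/idP/idP => ?; lra|apply/idP/idP => ?; lra].
  - rewrite mulr_ge0 ?divr_ge0 ?subr_ge0 ?(ltW al0)//=.
    have -> : pi = alpha * (T / 2) by rewrite mulrA aT mulrC mulKf.
    by rewrite ler_pM2l// /r; lra.
  - rewrite mulr_ge0 ?(ltW al0)//= -aT -mulrBr ler_pM2l// ler_norml /x /r.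
    by apply/andP; split; lra.
have mh : measurable_fun `[0, T] h.
  by case/integrableP : ih => /measurable_EFinP.
pose f_ n y := (h y * arc_bump alpha x r n y)%:E.
pose f y := (h y * \1_(`]a, b[%classic) y)%:E.
have mf_ n : measurable_fun `[0, T] (f_ n).
  apply/measurable_EFinP/measurable_realfun.measurable_funM => //.
  apply: measurable_funTS; apply: continuous_measurable_fun.
  exact: continuous_arc_bump.
have f_le n y : (`|f_ n y| <= `|(h y)%:E|)%E.
  rewrite /f_ /= lee_fin normrM (ger0_norm (arc_bump_ge0 _ _ _ _ _)).
  by rewrite ler_piMr// arc_bump_le1.
have if_ n : mu.-integrable `[0, T] (f_ n).
  apply: (@le_integrable _ _ _ mu _ (measurable_itv _) (f_ n) (EFin \o h)) => //.
  exact: mf_.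
have [] := @dominated_convergence _ _ R mu `[0, T]%classic
  (measurable_itv _) f_ f (fun y => `|(h y)%:E|)%E mf_.
- exact/measurable_EFinP/measurable_realfun.measurable_funM.
- apply: aeW => y yT; apply: cvg_EFin; first by apply: nearW.
  rewrite /f_ /f; apply: cvgM; first exact: cvg_cst.
  by rewrite indicE mem_setE -arcE//; exact: cvg_arc_bump.
- exact: integrable_abse.
- by apply: aeW => y n _; exact: f_le.
move=> if0 _ cf.
have -> : \int[mu]_(x in `[a, b]) h x = fine (\int[mu]_(x in `[0%R, T]) f x)%E.
  rewrite /Rintegral (_ : \int[mu]_(y in `[0%R, T]) f y =
    \int[mu]_(y in `[0%R, T]) ((EFin \o h) \_ `]a, b[) y)%E; last first.
    by apply: eq_integral => y _; rewrite restrict_EFin /= patch_indic.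
  rewrite -integral_mkcondr setIidr; last first.
    by move=> y /=; rewrite !in_itv/= => /andP[ay yb]; apply/andP; split; lra.
  rewrite integral_itv_bndoo//; apply/measurable_EFinP.
  by apply: measurable_funS mh => // y /=; rewrite !in_itv/= => /andP[ay yb];
    apply/andP; split; lra.
apply: fine_ge0; apply: cvge_ge cf; apply: nearW => n /=.
rewrite -(fineK (integrable_fin_num _ (if_ n)))// lee_fin.
apply: hpsi.
- exact: continuous_arc_bump.
- by apply: arc_bump_periodic; rewrite gt_eqF.
- by move=> y; exact: arc_bump_ge0.
Qed.

Lemma nondecreasing_derive1_ge0 (F : R -> R) x : {homo F : y z / y <= z} ->
  derivable F x 1 -> 0 <= derive1 F x.
Proof.
move=> ndF dF; rewrite derive1E /derive; apply: limr_ge => //.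
apply: nearW => e; rewrite /= [e%:A]mulr1; case: (ltgtP e 0) => [e0|e0|->].
- by rewrite mulr_le0// ?invr_le0 ?subr_le0 ?(ltW e0)// ndF// gerDr (ltW e0).
- by rewrite mulr_ge0 ?invr_ge0 ?subr_ge0 ?(ltW e0)// ndF// lerDr (ltW e0).
(* At a zero increment the quotient is 0, since the inverse of 0 is 0. *)
- by rewrite invr0 scale0r.
Qed.

(** The primitive of [h] is nondecreasing because integrals over subintervals are nonnegative, and
    by Lebesgue differentiation its derivative is [h] almost everywhere. *)
Lemma ae_ge0_of_periodic alpha h :
  let T := 2 * pi / alpha in
  0 < alpha -> mu.-integrable `[0, T] (EFin \o h) ->
  (forall psi, continuous psi -> periodic psi T -> (forall x, 0 <= psi x) ->
    0 <= \int[mu]_(x in `[0, T]) (h x * psi x)) ->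
  {ae mu, forall x, x \in `]0, T[ -> 0 <= h x}.
Proof.
move=> T al0 ih hpsi.
have T0 : 0 < T by rewrite divr_gt0// mulr_gt0// pi_gt0.
(* Extending [h] by 0 makes the primitive nondecreasing on the whole line. *)
pose g := h \_ `[0, T].
have ig : mu.-integrable setT (EFin \o g).
  by rewrite -restrict_EFin; apply/integrable_restrict => //=; rewrite setTI.
have igI (D : set R) : measurable D -> mu.-integrable D (EFin \o g).
  by move=> mD; apply: integrableS ig.
have g_ge0 a b : 0 <= a -> a <= b -> 0 <= \int[mu]_(x in `[a, b]) g x.
  move=> a0 ab; rewrite -Rintegral_mkcondr.
  have [aT|Ta] := leP a T; last first.
    rewrite (_ : _ `&` _ = set0) ?Rintegral_set0//.
    apply/seteqP; split => x //=;
      rewrite !in_itv/= => -[/andP[? ?] /andP[? ?]]; lra.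
  rewrite (_ : _ `&` _ = `[a, Num.min b T]%classic); last first.
    apply/seteqP; split => x /=; rewrite !in_itv/= le_min.
      by move=> [/andP[-> ->] /andP[_ ->]].
    by move=> /and3P[ax -> ->]; rewrite ax (le_trans a0).
  apply: (Rintegral_ge0_of_periodic al0 ih) => //; first by rewrite le_min ab.
  by rewrite ge_min lexx orbT.
pose F x := \int[mu]_(t in `[0, x]) g t.
have ndF : {homo F : x y / x <= y}.
  move=> x y xy; rewrite /F; have [x0|x0] := leP 0 x; last first.
    rewrite [leLHS](_ : _ = 0); last first.
      by rewrite set_itv_ge ?Rintegral_set0// bnd_simp -ltNge.
    have [y0|y0] := leP 0 y; first exact: g_ge0.
    by rewrite set_itv_ge ?Rintegral_set0// bnd_simp -ltNge.
  rewrite -subr_ge0 Rintegral_itvB//; last exact: igI.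
  by rewrite Rintegral_itv_obnd_cbnd ?g_ge0//; exact: igI.
have := @FTC1 R g (BLeft 0) _ _.
move=> /(_ (fun y => igI _ (measurable_itv _))).
move=> /(_ (integrable_locally (measurable_itv _) ih)).
apply: filterS; first exact: (ae_filter_ringOfSetsType mu).
move=> x /= dx /[!in_itv]/= /andP[x0 xT].
have [dF F'] := dx x0.
have <- : g x = h x by rewrite /g patchE mem_setE in_itv/= !ltW.
by rewrite -F'; exact: nondecreasing_derive1_ge0.
Qed.

End duality.

(** * The pointwise bound *)

Section energy.
Context {R : realType}.
Implicit Types (u v f g psi : R -> R) (m T : R).
Notation mu := (@lebesgue_measure R).

(** In this form the lower bound 1 and the monotonicity can be read off. *)
Lemma cothE (x : R) : 0 < x -> coth x = 1 + 2 / (expR (2 * x) - 1).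
Proof.
move=> x0; rewrite /coth expRN.
have e1 : 1 < expR x by rewrite expR_gt1.
have e0 : expR x != 0 by rewrite gt_eqF ?expR_gt0.
have -> : expR (2 * x) = expR x ^+ 2 by rewrite expRM_natl.
have h1 : expR x ^+ 2 - 1 != 0 by rewrite gt_eqF// subr_gt0 exprn_egt1.
by field; rewrite ?e0 ?h1 //= -expr2.
Qed.

Lemma coth_ge1 (x : R) : 0 < x -> 1 <= coth x.
Proof.
move=> x0; rewrite cothE// lerDl divr_ge0// subr_ge0 ltW// expR_gt1.
by rewrite mulr_gt0.
Qed.

Lemma coth_gt0 (x : R) : 0 < x -> 0 < coth x.
Proof. by move=> x0; rewrite (lt_le_trans ltr01)// coth_ge1. Qed.

Lemma coth_le (x y : R) : 0 < x -> x <= y -> coth y <= coth x.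
Proof.
move=> x0 xy; have y0 : 0 < y by rewrite (lt_le_trans x0).
rewrite !cothE// lerD2l ler_pM2l// lef_pV2 ?posrE ?subr_gt0 ?expR_gt1 ?mulr_gt0//.
by rewrite lerD2r ler_expR ler_pM2l.
Qed.

Lemma integrable_mul_of_sqr T f g :
  measurable_fun setT f -> measurable_fun setT g ->
  mu.-integrable `[0, T] (fun x => (f x ^+ 2)%:E) ->
  mu.-integrable `[0, T] (fun x => (g x ^+ 2)%:E) ->
  mu.-integrable `[0, T] (EFin \o (fun x => f x * g x)).
Proof.
move=> mf mg f2 g2.
apply: (@le_integrable _ _ _ mu _ (measurable_itv _) _
  (fun x => (f x ^+ 2)%:E + (g x ^+ 2)%:E)%E).
- by apply/measurable_EFinP/measurable_realfun.measurable_funM; exact: measurable_funTS.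
- move=> x _; rewrite -EFinD !abse_EFin lee_fin.
  rewrite [leRHS]ger0_norm ?addr_ge0 ?sqr_ge0//.
  rewrite normrM -(real_normK (num_real (f x))) -(real_normK (num_real (g x))).
  have := sqr_ge0 (`|f x| - `|g x|).
  have := normr_ge0 (f x); have := normr_ge0 (g x).
  by move: `|f x| `|g x| => a b a0 b0 ab; nra.
- exact: integrableD.
Qed.

Lemma continuous_sqr_integrable T f : continuous f ->
  mu.-integrable `[0, T] (fun x => (f x ^+ 2)%:E).
Proof.
move=> cf; apply: (@continuous_integrable_itv _ (fun x => f x ^+ 2)).
by move=> x; apply: cvgM; exact: cf.
Qed.

(** The energy of [u - s * phi] is nonnegative; its cross term is the integral of [u * psi] and its
    quadratic term is controlled by the maximum of the Green function. Keeping [s] free leaves a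
    quadratic inequality. *)
Lemma H1_per_dual_bound m T u v psi : 0 < m -> 0 < T -> H1_per T u v ->
  continuous psi -> periodic psi T -> (forall x, 0 <= psi x) -> forall s,
  2 * s * \int[mu]_(x in `[0, T]) (u x * psi x) <=
    \int[mu]_(x in `[0, T]) (v x ^+ 2 + m ^+ 2 * u x ^+ 2) +
    s ^+ 2 * (coth (m * T / 2) / (2 * m) *
      (\int[mu]_(x in `[0, T]) psi x) ^+ 2).
Proof.
move=> m0 T0 [[_ mu_ u2] [_ mv v2] uv] cpsi ppsi psi0 s.
have [phi [dphi [pphi pdphi dphiE ddphi phi_le]]] :=
  periodic_green_solution m0 T0 cpsi ppsi psi0.
set G := coth _ / _ in phi_le *.
set Y := \int[mu]_(x in `[0, T]) psi x in phi_le *.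
have cphi := derivable_continuous_all dphiE.
have cdphi := derivable_continuous_all ddphi.
have mc f : continuous f -> measurable_fun setT f by exact: continuous_measurable_fun.
have cddphi : continuous (fun x => m ^+ 2 * phi x - psi x).
  by move=> x; apply: cvgB; [apply: cvgM; [exact: cvg_cst|exact: cphi]|exact: cpsi].
have iM f g : measurable_fun setT f -> measurable_fun setT g ->
  mu.-integrable `[0, T] (fun x => (f x ^+ 2)%:E) ->
  mu.-integrable `[0, T] (fun x => (g x ^+ 2)%:E) ->
  mu.-integrable `[0, T] (EFin \o (fun x => f x * g x)).
  exact: integrable_mul_of_sqr.
have ic := @continuous_sqr_integrable T.
have iu : mu.-integrable `[0, T] (EFin \o (fun x => u x * phi x)).
  by apply: iM => //; [exact: mc|exact: ic].
have iupsi : mu.-integrable `[0, T] (EFin \o (fun x => u x * psi x)).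
  by apply: iM => //; [exact: mc|exact: ic].
have iv : mu.-integrable `[0, T] (EFin \o (fun x => v x * dphi x)).
  by apply: iM => //; [exact: mc|exact: ic].
have mI : measurable (`[0, T]%classic : set (measurableTypeR R)).
  exact: measurable_itv.
have iZ c f : mu.-integrable `[0, T] (EFin \o f) ->
    mu.-integrable `[0, T] (EFin \o (fun x => c * f x)).
  by move=> fi; exact: (@integrableZl _ _ R mu _ mI c (EFin \o f)).
have iD f g : mu.-integrable `[0, T] (EFin \o f) ->
    mu.-integrable `[0, T] (EFin \o g) ->
    mu.-integrable `[0, T] (EFin \o (fun x => f x + g x)).
  by move=> fi gi; exact: (@integrableD _ _ R mu _ mI (EFin \o f) (EFin \o g)).
(* The test function is [dphi], whose derivative is known from the equation of [phi]. *)
have weak : \int[mu]_(x in `[0, T]) (v x * dphi x) =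
    \int[mu]_(x in `[0, T]) (u x * psi x) -
    m ^+ 2 * \int[mu]_(x in `[0, T]) (u x * phi x).
  have d1E : derive1 dphi = (fun x => m ^+ 2 * phi x - psi x).
    by apply/funext => x; rewrite derive1E; apply: derive_val; exact: ddphi.
  have /uv : periodic_test T dphi.
    split; [exact: pdphi|by move=> x; case: (ddphi x)|].
    by rewrite d1E; exact: cddphi.
  rewrite d1E => weak; rewrite -[LHS]opprK -weak -opprB; congr (- _).
  rewrite -RintegralZl// -RintegralB//; last exact: iZ.
  by apply: eq_Rintegral => x _; ring.
(* [e] is the derivative of [phi * dphi], which takes equal values at 0 and [T], so the integral of
   [e] vanishes. *)
have energy : \int[mu]_(x in `[0, T]) (phi x * psi x) =
    \int[mu]_(x in `[0, T]) (dphi x ^+ 2 + m ^+ 2 * phi x ^+ 2).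
  pose e x := dphi x ^+ 2 + m ^+ 2 * phi x ^+ 2 - phi x * psi x.
  have ce : continuous e.
    move=> x; apply: cvgB; last by apply: cvgM; [exact: cphi|exact: cpsi].
    apply: cvgD; first by apply: cvgM; exact: cdphi.
    by apply: cvgM; [exact: cvg_cst|apply: cvgM; exact: cphi].
  have de (x : R) : is_derive x 1 (fun x => phi x * dphi x) (e x).
    have := is_derive_mulf (dphiE x) (ddphi x).
    by rewrite (_ : _ + _ = e x)// /e; ring.
  have := Rintegral_derive T0 ce de.
  rewrite -[X in phi X]add0r -[X in dphi X]add0r pphi pdphi subrr RintegralB.
  - by move=> /eqP; rewrite subr_eq0 => /eqP.
  - exact: mI.
  - apply: iD; first exact: ic.
    by apply: iZ; exact: ic.
  - by apply: iM; [exact: mc|exact: mc|exact: ic|exact: ic].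
have phipsi : \int[mu]_(x in `[0, T]) (phi x * psi x) <= G * Y ^+ 2.
  rewrite expr2 mulrA /Y -RintegralZl//; last exact: continuous_integrable_itv.
  apply: le_Rintegral => //.
  - by apply: iM; [exact: mc|exact: mc|exact: ic|exact: ic].
  - by apply: iZ; exact: continuous_integrable_itv.
  - by move=> x _; rewrite ler_wpM2r.
have : 0 <= \int[mu]_(x in `[0, T])
    ((v x - s * dphi x) ^+ 2 + m ^+ 2 * (u x - s * phi x) ^+ 2).
  apply: Rintegral_ge0 => x _.
  by rewrite addr_ge0 ?sqr_ge0// mulr_ge0 ?sqr_ge0.
rewrite (_ : \int[mu]_(x in _) _ = \int[mu]_(x in `[0, T])
   ((v x ^+ 2 + m ^+ 2 * u x ^+ 2) +
   (((- (2 * s)) * (v x * dphi x) + (- (2 * s * m ^+ 2)) * (u x * phi x)) +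
   s ^+ 2 * (dphi x ^+ 2 + m ^+ 2 * phi x ^+ 2)))); last first.
  by apply: eq_Rintegral => x _; ring.
have iE f g : mu.-integrable `[0, T] (fun x => (f x ^+ 2)%:E) ->
    mu.-integrable `[0, T] (fun x => (g x ^+ 2)%:E) ->
    mu.-integrable `[0, T] (EFin \o (fun x => f x ^+ 2 + m ^+ 2 * g x ^+ 2)).
  by move=> fi gi; apply: iD => //; exact: iZ.
rewrite RintegralD//; last 2 first.
- exact: iE.
- by apply/iD; [apply/iD; exact: iZ|apply/iZ/iE; exact: ic].
rewrite [X in _ + X]RintegralD//; last 2 first.
- by apply/iD; exact: iZ.
- by apply: iZ; apply: iE; exact: ic.
rewrite [X in _ + (X + _)]RintegralD//; [|exact: iZ|exact: iZ].
rewrite !RintegralZl//; last by apply: iE; exact: ic.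
rewrite weak -energy => pos.
have := ler_wpM2l (sqr_ge0 s) phipsi.
set M := \int[mu]_(x in _) (v x ^+ 2 + _) in pos *.
by move: pos; lra.
Qed.

(** The best choice is [s = X / (G * Y ^+ 2)]. *)
Lemma normr_le_of_quadratic (X Y G M : R) : 0 < G -> 0 <= Y ->
  (forall s, 2 * s * X <= M + s ^+ 2 * (G * Y ^+ 2)) ->
  `|X| <= Num.sqrt (G * M) * Y.
Proof.
move=> G0 Y0 h.
have M0 : 0 <= M by have := h 0; rewrite mulr0 mul0r expr0n/= mul0r addr0.
have GM0 : 0 <= G * M by rewrite mulr_ge0// ltW.
rewrite -(ler_pXn2r (n := 2))// ?nnegrE ?mulr_ge0 ?sqrtr_ge0//.
rewrite real_normK ?num_real// exprMn sqr_sqrtr//.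
move: Y0; rewrite le_eqVlt => /predU1P[Y0|Y0].
  have [->|X0] := eqVneq X 0; first by rewrite expr0n mulr_ge0// sqr_ge0.
  (* When [Y = 0] the quadratic term disappears, and this [s] would give [M + 1 <= M]. *)
  have := h ((M + 1) / (2 * X)); rewrite -Y0 expr0n/= !mulr0 addr0.
  rewrite (_ : 2 * _ * X = M + 1); last by field.
  by rewrite gerDl ler10.
have GY0 : 0 < G * Y ^+ 2 by rewrite mulr_gt0// exprn_gt0.
have := h (X / (G * Y ^+ 2)).
have -> : 2 * (X / (G * Y ^+ 2)) * X = 2 * (X ^+ 2 / (G * Y ^+ 2)).
  by rewrite expr2; ring.
have -> : (X / (G * Y ^+ 2)) ^+ 2 * (G * Y ^+ 2) = X ^+ 2 / (G * Y ^+ 2).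
  by field; rewrite !gt_eqF.
move=> {}h; have : X ^+ 2 / (G * Y ^+ 2) <= M by lra.
by rewrite ler_pdivrMr// => /le_trans; apply; rewrite mulrCA mulrA.
Qed.

(** The L^oo norm is defined by cases on whether the whole space has positive measure; this selects
    the essential supremum. *)
Lemma lebesgue_measureT_gt0 : (0 < mu [set: R])%E.
Proof. rewrite -set_itvNyy lebesgue_measure_itv/=. by rewrite adde_gt0. Qed.

Lemma sup_norm_le u (C : R) : {ae mu, forall x, `|u x| <= C} ->
  (sup_norm u <= C%:E)%E.
Proof.
move=> uC; rewrite /sup_norm unlock lebesgue_measureT_gt0; apply/ess_supP.
move: uC; apply: filterS; first exact: (ae_filter_ringOfSetsType mu).
by move=> x ux /=; rewrite lee_fin.
Qed.

(** By the dual bound, [C - u] and [C + u] have nonnegative integral against every nonnegative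
    periodic test function, hence are nonnegative almost everywhere on one period; periodicity does
    the rest. *)
Lemma H1_per_sup_norm_le m alpha u v :
  let T := 2 * pi / alpha in
  0 < m -> 0 < alpha -> H1_per T u v ->
  (sup_norm u <= (Num.sqrt (coth (m * T / 2) / (2 * m) *
     \int[mu]_(x in `[0, T]) (v x ^+ 2 + m ^+ 2 * u x ^+ 2)))%:E)%E.
Proof.
move=> T m0 al0 H1.
have T0 : 0 < T by rewrite divr_gt0// mulr_gt0// pi_gt0.
have [[pu mu_ u2] _ _] := H1.
set C := Num.sqrt _.
have C0 : 0 <= C by exact: sqrtr_ge0.
have mI : measurable (`[0, T]%classic : set (measurableTypeR R)).
  exact: measurable_itv.
have iupsi psi : continuous psi ->
    mu.-integrable `[0, T] (EFin \o (fun x => u x * psi x)).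
  move=> cpsi; apply: integrable_mul_of_sqr => //.
    exact: continuous_measurable_fun.
  exact: continuous_sqr_integrable.
have icst c : mu.-integrable `[0, T] (EFin \o cst (c : R)).
  by apply: continuous_integrable_itv; exact: cst_continuous.
have iu : mu.-integrable `[0, T] (EFin \o u).
  have := iupsi (cst 1) (@cst_continuous _ _ _).
  by apply: eq_integrable => // x _ /=; rewrite mulr1.
have G0 : 0 < coth (m * T / 2) / (2 * m).
  by apply: divr_gt0; [apply: coth_gt0; rewrite divr_gt0// mulr_gt0|rewrite mulr_gt0].
have dual psi : continuous psi -> periodic psi T -> (forall x, 0 <= psi x) ->
    `|\int[mu]_(x in `[0, T]) (u x * psi x)| <=
      C * \int[mu]_(x in `[0, T]) psi x.
  move=> cpsi ppsi psi0; apply: normr_le_of_quadratic => //.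
    by apply: Rintegral_ge0 => x _; exact: psi0.
  exact: H1_per_dual_bound.
(* Used with [e = 1] and [e = -1], which gives both halves of the bound on the absolute value. *)
have ae_one (e : R) : `|e| = 1 -> {ae mu, forall x, x \in `]0, T[ -> e * u x <= C}.
  move=> e1.
  have ieu : mu.-integrable `[0, T] (EFin \o (fun x => e * u x)).
    exact: (@integrableZl _ _ R mu _ mI e (EFin \o u)).
  have ih : mu.-integrable `[0, T] (EFin \o (fun x => C - e * u x)).
    exact: (@integrableB _ _ R mu _ mI _ _ (icst C) ieu).
  have := @ae_ge0_of_periodic R alpha _ al0 ih.
  have hh psi : continuous psi -> periodic psi T -> (forall x, 0 <= psi x) ->
      0 <= \int[mu]_(x in `[0, T]) ((C - e * u x) * psi x).
    move=> cpsi ppsi psi0.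
    have ipsi : mu.-integrable `[0, T] (EFin \o psi).
      exact: continuous_integrable_itv.
    rewrite (_ : Rintegral _ _ _ =
        \int[mu]_(x in `[0, T]) (C * psi x - e * (u x * psi x))); last first.
      by apply: eq_Rintegral => x _; ring.
    rewrite RintegralB//; last 2 first.
    - exact: (@integrableZl _ _ R mu _ mI C (EFin \o psi)).
    - exact: (@integrableZl _ _ R mu _ mI e (EFin \o (fun x => u x * psi x))
        (iupsi _ cpsi)).
    rewrite !RintegralZl//; last exact: iupsi.
    rewrite subr_ge0 (le_trans (ler_norm _))// normrM e1 mul1r.
    exact: dual.
  move=> /(_ hh); apply: filterS; first exact: (ae_filter_ringOfSetsType mu).
  by move=> x /= + xT => /(_ xT); rewrite subr_ge0.
pose A := [set x | C < `|u x|].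
have mA : measurable (A : set R).
  rewrite (_ : A = ((fun x => `|u x|)) @^-1` `]C, +oo[); last first.
    by apply/seteqP; split => x /=; rewrite in_itv/= andbT.
  rewrite -[X in measurable X]setTI.
  by apply: measurableT_comp.
have pu' x : u (x - T) = u x by rewrite -[in RHS](subrK T x) pu.
apply: sup_norm_le.
have nA : mu.-negligible A.
  apply: (@periodic_negligible _ T A T0 mA).
  - by move=> x; rewrite /A /= pu.
  - by move=> x; rewrite /A /= pu'.
  apply/negligibleP; first exact: measurableI.
  (* The almost everywhere bound concerns the open interval, so the end point 0 of the period is
     added as a null set. *)
  have n0 : mu.-negligible [set (0 : R)].
    by apply/negligibleP => //; exact: lebesgue_measure_set1.
  have nT : mu.-negligible (~` [set x | x \in `]0, T[ -> `|u x| <= C]).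
    have := ae_one (-1); rewrite normrN1 => /(_ erefl) l.
    have := ae_one 1; rewrite normr1 => /(_ erefl) r.
    suff : {ae mu, forall x, x \in `]0, T[ -> `|u x| <= C} by [].
    apply: filterS2 l r; first exact: (ae_filter_ringOfSetsType mu).
    move=> x /= ul ur xT; have := ul xT; have := ur xT.
    by rewrite mul1r mulN1r ler_norml lerNl => -> ->.
  apply: negligibleS (negligibleU n0 nT) => x [/= Ax] /[!in_itv]/= /andP[].
  rewrite le_eqVlt => /predU1P[<-|x0 xT]; first by left.
  have xI : x \in `]0, T[ by rewrite in_itv/= x0 xT.
  by right => uC; have := uC xI; rewrite leNgt Ax.
by apply: negligibleS nA => x /= /negP; rewrite -ltNge.
Qed.

End energy.

(** * The supremum and the upper bound *)

Section K1.
Context {R : realType}.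
Implicit Types (alpha beta lambda a b x : R).
Notation mu := (@lebesgue_measure R).

Definition K1_value beta lambda : R :=
  Num.sqrt lambda
    * (coth (pi * Num.sqrt (beta + lambda)) / Num.sqrt (beta + lambda)).

(** Both [coth] and the inverse decrease. This carries the constant 1 from [beta_star] to every
    larger [beta]. *)
Lemma K1_value_le beta1 beta2 lambda : 0 <= beta1 -> beta1 <= beta2 ->
  0 < lambda -> K1_value beta2 lambda <= K1_value beta1 lambda.
Proof.
move=> b1 b12 l0.
have s1 : 0 < Num.sqrt (beta1 + lambda) by rewrite sqrtr_gt0 ltr_wpDl.
have s2 : 0 < Num.sqrt (beta2 + lambda).
  by rewrite sqrtr_gt0 ltr_wpDl// (le_trans b1).
have s12 : Num.sqrt (beta1 + lambda) <= Num.sqrt (beta2 + lambda).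
  by rewrite ler_wsqrtr// lerD2r.
have p0 : 0 < pi :> R := pi_gt0 R.
apply: ler_wpM2l; first exact: sqrtr_ge0.
apply: ler_pM.
- by apply/ltW/coth_gt0; rewrite mulr_gt0.
- by rewrite invr_ge0 ltW.
- by apply: coth_le; [rewrite mulr_gt0|rewrite ler_pM2l].
- by rewrite lef_pV2.
Qed.

Lemma K1_values_neq0 beta : K1_values beta !=set0.
Proof. by exists (K1_value beta 1); exists 1 => //=. Qed.

(** The ratio of the square roots is at most 1 and [coth] decreases. Boundedness makes [sup] a true
    supremum and not a default value. *)
Lemma K1_values_has_ubound beta : 0 < beta -> has_ubound (K1_values beta).
Proof.
move=> b0; exists (coth (pi * Num.sqrt beta)) => _ [l /= l0 <-].
have p0 : 0 < pi :> R := pi_gt0 R.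
have s0 : 0 < Num.sqrt beta by rewrite sqrtr_gt0.
have s1 : 0 < Num.sqrt (beta + l) by rewrite sqrtr_gt0 addr_gt0.
have cle : coth (pi * Num.sqrt (beta + l)) <= coth (pi * Num.sqrt beta).
  apply: coth_le; first by rewrite mulr_gt0.
  by rewrite ler_pM2l// ler_wsqrtr// lerDl ltW.
have c0 : 0 < coth (pi * Num.sqrt (beta + l)) by rewrite coth_gt0// mulr_gt0.
rewrite mulrA ler_pdivrMr//.
apply: (@le_trans _ _ (Num.sqrt (beta + l) * coth (pi * Num.sqrt (beta + l)))).
  by rewrite ler_pM2r// ler_wsqrtr// lerDr ltW.
by rewrite mulrC ler_pM2r.
Qed.

Lemma K1_values_has_sup beta : 0 < beta -> has_sup (K1_values beta).
Proof.
by move=> b0; split; [exact: K1_values_neq0|exact: K1_values_has_ubound].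
Qed.

Lemma K1_value_le_sup beta lambda : 0 < beta -> 0 < lambda ->
  K1_value beta lambda <= sup (K1_values beta).
Proof.
move=> b0 l0; apply: ub_le_sup; first exact: K1_values_has_ubound.
by exists lambda.
Qed.

Lemma K1_value_gt0 beta lambda : 0 <= beta -> 0 < lambda ->
  0 < K1_value beta lambda.
Proof.
move=> b0 l0.
have s1 : 0 < Num.sqrt (beta + lambda) by rewrite sqrtr_gt0 ltr_wpDl.
rewrite mulr_gt0 ?sqrtr_gt0// divr_gt0// coth_gt0// mulr_gt0//.
exact: pi_gt0.
Qed.

Lemma K1_values_sup_ge1 beta : 0 < beta -> 1 <= sup (K1_values beta).
Proof.
move=> b0; set K := sup _; rewrite leNgt; apply/negP => K1.
have K0 : 0 < K.
  apply: lt_le_trans (K1_value_le_sup b0 ltr01).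
  by apply: K1_value_gt0 => //; exact: ltW.
have k0 : 0 < 1 - K ^+ 2 by rewrite subr_gt0 exprn_ilt1// ltW.
(* Twice the solution of [l = K ^+ 2 * (beta + l)]: beyond that solution the ratio of the square
   roots exceeds [K]. *)
pose l := 2 * K ^+ 2 * beta / (1 - K ^+ 2).
have l0 : 0 < l by rewrite divr_gt0// !mulr_gt0// exprn_gt0.
have s1 : 0 < Num.sqrt (beta + l) by rewrite sqrtr_gt0 addr_gt0.
have : Num.sqrt l / Num.sqrt (beta + l) <= K.
  apply: le_trans (K1_value_le_sup b0 l0); rewrite /K1_value.
  rewrite ler_pM2l ?sqrtr_gt0// ler_pMl ?invr_gt0//.
  by apply: coth_ge1; rewrite mulr_gt0// pi_gt0.
rewrite ler_pdivrMr// -(ler_pXn2r (n := 2))// ?nnegrE ?sqrtr_ge0 ?mulr_ge0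
  ?(ltW K0)//.
rewrite exprMn !sqr_sqrtr ?addr_ge0 ?(ltW b0) ?(ltW l0)//.
have : l * (1 - K ^+ 2) = 2 * K ^+ 2 * beta by rewrite /l; field; rewrite gt_eqF.
have : 0 < K ^+ 2 * beta by rewrite mulr_gt0// exprn_gt0.
by move=> p0 e1 e2; nra.
Qed.

Lemma sup_K1_values_le beta K :
  (forall lambda, 0 < lambda -> K1_value beta lambda <= K) ->
  sup (K1_values beta) <= K.
Proof.
move=> h; apply: ge_sup; first exact: K1_values_neq0.
by move=> _ [l l0 <-]; exact: h.
Qed.

(* The infimum over [t] of the left-hand side is [a * b]; it need not be
   attained when [a] or [b] vanishes. *)
Lemma amgm_weight_near a b (e : R) : 0 <= a -> 0 <= b -> 0 < e ->
  exists2 t, 0 < t & (a ^+ 2 / t + t * b ^+ 2) / 2 <= a * b + e.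
Proof.
(* Shifting [a] and [b] by [d] makes the optimal weight [(a + d) / (b + d)] well defined and costs
   at most [d * (a + b) / 2 <= e]. *)
move=> a0 b0 e0; pose d := 2 * e / (a + b + 1).
have ab1 : 0 < a + b + 1 by rewrite ltr_wpDl ?addr_ge0.
have d0 : 0 < d by rewrite divr_gt0// mulr_gt0.
have ad : 0 < a + d by rewrite ltr_wpDl.
have bd : 0 < b + d by rewrite ltr_wpDl.
exists ((a + d) / (b + d)); first by rewrite divr_gt0.
have dE : d * (a + b + 1) = 2 * e by rewrite /d; field; rewrite gt_eqF.
have h1 : a ^+ 2 / ((a + d) / (b + d)) <= a * (b + d).
  rewrite invf_div mulrA ler_pdivrMr// expr2 -!mulrA ler_wpM2l//.
  by rewrite mulrC ler_pM2l// lerDl ltW.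
have h2 : (a + d) / (b + d) * b ^+ 2 <= (a + d) * b.
  rewrite mulrAC ler_pdivrMr// -mulrA ler_pM2l// expr2 ler_wpM2l//.
  by rewrite lerDl ltW.
by nra.
Qed.

Lemma interpolation_inequality_sup alpha beta : 0 < alpha -> 0 < beta ->
  interpolation_inequality alpha beta (sup (K1_values beta)).
Proof.
move=> al0 b0 T u v H1; set K := sup _.
have T0 : 0 < T by rewrite divr_gt0// mulr_gt0// pi_gt0.
have [[_ mu_ u2] [_ mv v2] _] := H1.
have mI : measurable (`[0, T]%classic : set (measurableTypeR R)).
  exact: measurable_itv.
have K0 : 0 < K.
  apply: lt_le_trans (K1_value_le_sup b0 ltr01).
  by apply: K1_value_gt0 => //; exact: ltW.
set A := \int[mu]_(x in _) (v x ^+ 2 + _).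
set B := \int[mu]_(x in _) (u x ^+ 2).
have iu c : mu.-integrable `[0, T] (EFin \o (fun x => c * u x ^+ 2)).
  exact: (@integrableZl _ _ R mu _ mI c _ u2).
have B0 : 0 <= B by apply: Rintegral_ge0 => x _; exact: sqr_ge0.
have A0 : 0 <= A.
  apply: Rintegral_ge0 => x _.
  by rewrite addr_ge0 ?sqr_ge0// mulr_ge0 ?sqr_ge0// mulr_ge0 ?sqr_ge0// ltW.
have bound t : 0 < t ->
    (sup_norm u <= (Num.sqrt (K * ((A / t + t * B) / 2)))%:E)%E.
  (* With this choice [t = alpha * sqrt lambda], and the energy with [m = alpha * s] splits as
     [A + t ^+ 2 * B]. *)
  move=> t0; pose lambda := (t / alpha) ^+ 2.
  have l0 : 0 < lambda by rewrite exprn_gt0// divr_gt0.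
  pose s := Num.sqrt (beta + lambda).
  have s0 : 0 < s by rewrite sqrtr_gt0 addr_gt0.
  have ms0 : 0 < alpha * s by rewrite mulr_gt0.
  apply: le_trans (H1_per_sup_norm_le ms0 al0 H1) _.
  rewrite lee_fin ler_wsqrtr// -/T.
  have -> : alpha * s * T / 2 = pi * s by rewrite /T; field; rewrite gt_eqF.
  have -> : \int[mu]_(x in `[0, T]) (v x ^+ 2 + (alpha * s) ^+ 2 * u x ^+ 2) =
      A + t ^+ 2 * B.
    rewrite /A /B -RintegralZl// -RintegralD//; last first.
      exact: (@integrableD _ _ R mu _ mI (EFin \o (fun x => v x ^+ 2))
        (EFin \o (fun x => alpha ^+ 2 * beta * u x ^+ 2)) v2 (iu _)).
    apply: eq_Rintegral => x _.
    rewrite exprMn sqr_sqrtr ?addr_ge0 ?ltW// /lambda; field.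
    by rewrite gt_eqF.
  have := K1_value_le_sup b0 l0; rewrite -/K /K1_value -/s.
  rewrite /lambda sqrtr_sqr gtr0_norm ?divr_gt0// => hK.
  have -> : coth (pi * s) / (2 * (alpha * s)) * (A + t ^+ 2 * B) =
      t / alpha * (coth (pi * s) / s) * ((A / t + t * B) / 2).
    by field; rewrite !gt_eqF.
  by rewrite ler_wpM2r// divr_ge0// addr_ge0 ?divr_ge0 ?mulr_ge0// ltW.
have sup0 : (0 <= sup_norm u)%E by exact: Lnorm_ge0.
(* Any single weight shows that the norm is finite; the weight is optimized afterwards. *)
have := bound 1 ltr01.
move: bound sup0; case: (sup_norm u) => [r| |//] bound; last by rewrite leye_eq.
rewrite lee_fin => r0 _; rewrite -EFin_expe lee_fin.
apply/ler_addgt0Pr => e e0.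
have eK0 : 0 < e / K by rewrite divr_gt0.
have [t t0 ht] := amgm_weight_near (sqrtr_ge0 A) (sqrtr_ge0 B) eK0.
have := bound _ t0; rewrite lee_fin => rt.
have r2 : r ^+ 2 <= K * ((A / t + t * B) / 2).
  have X0 : 0 <= K * ((A / t + t * B) / 2).
    by rewrite mulr_ge0 ?(ltW K0)// divr_ge0// addr_ge0 ?divr_ge0 ?mulr_ge0// ltW.
  by rewrite -[leRHS]sqr_sqrtr// ler_pXn2r// nnegrE ?sqrtr_ge0.
apply: le_trans r2 _.
move: ht; rewrite !sqr_sqrtr// -(ler_pM2l K0) => /le_trans; apply.
by rewrite mulrDr mulrA [K * (e / K)]mulrC divfK// gt_eqF.
Qed.

End K1.

(** * Sharpness *)

Section sharpness.
Context {R : realType}.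
Implicit Types (alpha beta lambda T x m : R) (f g : R -> R).
Notation mu := (@lebesgue_measure R).

(** The extremal hyperbolic cosine is not periodic, whereas [H1_per] asks for periodicity on the
    whole line; only the values of [f] on [[0, T[] matter. *)
Definition per_ext T f x : R := f (x - T * (Num.floor (x / T))%:~R).

Lemma per_ext_periodic T f : 0 < T -> periodic (per_ext T f) T.
Proof.
move=> T0 x; rewrite /per_ext mulrDl divff ?gt_eqF//.
by rewrite floorDrz ?rpred1// floor1 intrD mulrDr mulr1; congr f; ring.
Qed.

Lemma per_ext_id T f x : 0 < T -> x \in `[0, T[ -> per_ext T f x = f x.
Proof.
move=> T0; rewrite in_itv/= => /andP[x0 xT]; rewrite /per_ext.
suff -> : Num.floor (x / T) = 0 by rewrite mulr0 subr0.
apply: floor_def; rewrite add0r ler_pdivlMr// ltr_pdivrMr//.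
by rewrite mul0r mul1r x0.
Qed.

Lemma measurable_per_ext T f : 0 < T -> measurable_fun setT f ->
  measurable_fun setT (per_ext T f).
Proof.
move=> T0 mf; apply: (measurableT_comp mf).
apply: measurable_realfun.measurable_funB => //.
apply: measurable_realfun.measurable_funM => //.
apply: nondecreasing_measurable => // x y xy.
by rewrite ler_int le_floor// ler_pM2r// invr_gt0.
Qed.

(** On [[0, T]] the two functions can differ only at [T], a null set. This serves to replace
    periodic extensions by the formulas they extend. *)
Lemma integrable_eq_itvco T f g : 0 < T -> measurable_fun setT f ->
  continuous g -> {in `[0, T[, f =1 g} ->
  mu.-integrable `[0, T] (EFin \o f).
Proof.
move=> T0 mf cg fg.
have mfT : measurable_fun `[0, T] (EFin \o f).
  by apply/measurable_EFinP; exact: measurable_funTS.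
apply: ((@negligible_integrable _ _ R mu `[0, T]%classic [set T] (EFin \o f)
  _ _ mfT (lebesgue_measure_set1 T)).2) => //.
have DE : `[0, T] `\` [set T] = `[0, T[%classic :> set R.
  apply/seteqP; split => x /=; rewrite !in_itv/=.
    by move=> [/andP[-> xT] /eqP xneT]; rewrite lt_neqAle xneT.
  by move=> /andP[-> xT]; rewrite ltW//; split => // xE; rewrite xE ltxx in xT.
rewrite DE.
have : mu.-integrable `[0, T[ (EFin \o g).
  apply: integrableS (continuous_integrable_itv 0 T cg) => //.
  exact: subset_itv_co_cc.
by apply: eq_integrable => // x; rewrite inE/= => xT; rewrite fg.
Qed.

Lemma Rintegral_eq_itvco T f g : 0 < T -> measurable_fun setT f ->
  continuous g -> {in `[0, T[, f =1 g} ->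
  \int[mu]_(x in `[0, T]) f x = \int[mu]_(x in `[0, T]) g x.
Proof.
move=> T0 mf cg fg.
rewrite -!Rintegral_itv_bndo_bndc.
- by apply: eq_Rintegral => x; rewrite inE/= => xT; rewrite fg.
- apply: integrableS (continuous_integrable_itv 0 T cg) => //.
  exact: subset_itv_co_cc.
- apply: integrableS (integrable_eq_itvco T0 mf cg fg) => //.
  exact: subset_itv_co_cc.
Qed.

(** Integration by parts against a periodic test function: [f T = f 0] cancels the boundary terms,
    while the extension of [g] may jump. *)
Lemma H1_per_per_ext T f g : 0 < T -> (forall x, is_derive x 1 f (g x)) ->
  continuous g -> f T = f 0 -> H1_per T (per_ext T f) (per_ext T g).
Proof.
move=> T0 df cg f0.
have cf := derivable_continuous_all df.
have mc h : continuous h -> measurable_fun setT (per_ext T h).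
  by move=> ch; apply: measurable_per_ext => //; exact: continuous_measurable_fun.
have L2 h : continuous h -> periodic_L2 T (per_ext T h).
  move=> ch; split; [exact: per_ext_periodic|exact: mc|].
  apply: (@integrable_eq_itvco T (fun x => per_ext T h x ^+ 2) (fun x => h x ^+ 2)) => //.
  - by apply: measurable_realfun.measurable_funX; exact: mc.
  - by move=> x; apply: cvgM; exact: ch.
  - by move=> x xT; rewrite per_ext_id.
split; [exact: L2|exact: L2|].
move=> phi [pphi dphi cphi'].
have dphiE x : is_derive x 1 phi (derive1 phi x).
  by apply: DeriveDef; [exact: dphi|rewrite derive1E].
have cphi := derivable_continuous_all dphiE.
rewrite (Rintegral_eq_itvco T0 (f := fun x => per_ext T f x * derive1 phi x)
  (g := fun x => f x * derive1 phi x)); last 3 first.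
- apply: measurable_realfun.measurable_funM; first exact: mc.
  exact: continuous_measurable_fun.
- by move=> x; apply: cvgM; [exact: cf|exact: cphi'].
- by move=> x xT; rewrite per_ext_id.
rewrite (Rintegral_eq_itvco T0 (f := fun x => per_ext T g x * phi x)
  (g := fun x => g x * phi x)); last 3 first.
- apply: measurable_realfun.measurable_funM; first exact: mc.
  exact: continuous_measurable_fun.
- by move=> x; apply: cvgM; [exact: cg|exact: cphi].
- by move=> x xT; rewrite per_ext_id.
have cfphi : continuous (fun x => f x * derive1 phi x).
  by move=> x; apply: cvgM; [exact: cf|exact: cphi'].
have cgphi : continuous (fun x => g x * phi x).
  by move=> x; apply: cvgM; [exact: cg|exact: cphi].
have d x : is_derive x 1 (fun x => f x * phi x) (f x * derive1 phi x + g x * phi x).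
  have := is_derive_mulf (df x) (dphiE x).
  by rewrite [phi x * g x]mulrC.
have cs : continuous (fun x => f x * derive1 phi x + g x * phi x).
  by move=> x; apply: cvgD; [exact: cfphi|exact: cgphi].
have := Rintegral_derive T0 cs d.
rewrite f0 -[X in phi X]add0r pphi subrr RintegralD//; last 2 first.
- exact: continuous_integrable_itv.
- exact: continuous_integrable_itv.
by move=> /eqP; rewrite addr_eq0 => /eqP.
Qed.

(** A value at one point says nothing about an essential supremum; by continuity any smaller bound
    would fail on an interval to the right of 0, of positive measure. *)
Lemma sup_norm_ge T f g : 0 < T -> continuous f ->
  {in `[0, T[, g =1 f} -> ((f 0)%:E <= sup_norm g)%E.
Proof.
move=> T0 cf gf; rewrite leNgt; apply/negP.
have : (0 <= sup_norm g)%E by exact: Lnorm_ge0.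
case E : (sup_norm g) => [r| |]//; rewrite lee_fin lte_fin => r0 rf0.
have nA : {ae mu, forall x, `|g x| <= r}.
  have : (sup_norm g <= r%:E)%E by rewrite E.
  rewrite /sup_norm unlock lebesgue_measureT_gt0 => /ess_supP.
  by apply: negligibleS => x /=; apply: contra_not; rewrite lee_fin.
have /nbhs_ballP[d /= d0 hd] : \forall x \near (0 : R), r < f x.
  exact: (cvgr_gt _ (cf 0)).
pose e := Num.min d T.
have e0 : 0 < e by rewrite lt_min d0.
have nI : mu.-negligible `]0, e[%classic.
  apply: negligibleS nA => x; rewrite /= in_itv/= lt_min => /and3P[x0 xd xT].
  apply/negP; rewrite -ltNge gf; last by rewrite in_itv/= ltW.
  apply: lt_le_trans (ler_norm _); apply: hd.
  by rewrite /ball/= sub0r normrN gtr0_norm.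
have : mu `]0, e[%classic = 0%E by apply/negligibleP.
rewrite lebesgue_measure_itv/= lte_fin e0 -EFinB subr0 => -[] e00.
by rewrite e00 ltxx in e0.
Qed.

(** The total integrand is the derivative of [f * g], so the weighted energy reduces to boundary
    terms. *)
Lemma Rintegral_energy T a b f g : 0 < T ->
  (forall x, is_derive x 1 f (g x)) ->
  (forall x, is_derive x 1 g ((a + b) * f x)) ->
  \int[mu]_(x in `[0, T]) (g x ^+ 2 + a * f x ^+ 2) +
    b * \int[mu]_(x in `[0, T]) (f x ^+ 2) = f T * g T - f 0 * g 0.
Proof.
move=> T0 df dg.
have cf := derivable_continuous_all df.
have cg := derivable_continuous_all dg.
have cff : continuous (fun x => f x ^+ 2) by move=> x; apply: cvgM; exact: cf.
have cgg : continuous (fun x => g x ^+ 2) by move=> x; apply: cvgM; exact: cg.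
have cZ c : continuous (fun x => c * f x ^+ 2).
  by move=> x; apply: cvgM; [exact: cvg_cst|exact: cff].
have cE c : continuous (fun x => g x ^+ 2 + c * f x ^+ 2).
  by move=> x; apply: cvgD; [exact: cgg|exact: cZ].
have d (x : R) : is_derive x 1 (fun x => f x * g x) (g x ^+ 2 + (a + b) * f x ^+ 2).
  have := is_derive_mulf (df x) (dg x).
  by rewrite (_ : _ + _ = g x ^+ 2 + (a + b) * f x ^+ 2)//; ring.
rewrite -(Rintegral_derive T0 (cE _) d) -RintegralZl//; last first.
  exact: continuous_integrable_itv.
rewrite -RintegralD//; last 2 first.
- exact: continuous_integrable_itv.
- exact: continuous_integrable_itv.
by apply: eq_Rintegral => x _; ring.
Qed.

(** [f] is [2 cosh (m (x - T / 2))], a multiple of the Green function on one period, and [g] is its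
    derivative; the last equation reads [g T = f 0 * m * tanh (m T / 2)]. *)
Lemma sinh_cosh_pair m T : 0 < m -> 0 < T -> exists f g : R -> R,
  [/\ forall x, is_derive x 1 f (g x),
      forall x, is_derive x 1 g (m ^+ 2 * f x),
      f T = f 0, g 0 = - g T & 0 < f 0 /\ g T = f 0 * m / coth (m * T / 2)].
Proof.
move=> m0 T0.
pose ep x := expR (m * (x - T / 2)).
pose en x := expR (- m * (x - T / 2)).
have dep x : is_derive x 1 ep (m * ep x).
  exact: is_derive_shift_arg (is_derive_expR_mul m (x - T / 2)).
have den x : is_derive x 1 en (- m * en x).
  exact: is_derive_shift_arg (is_derive_expR_mul (- m) (x - T / 2)).
have ep0 : ep 0 = en T by congr expR; field.
have en0 : en 0 = ep T by congr expR; field.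
exists (fun x => ep x + en x), (fun x => m * (ep x - en x)); split.
- move=> x; have := is_derive_addf (dep x) (den x).
  by rewrite (_ : _ + _ = m * (ep x - en x))//; ring.
- move=> x; have := is_derive_mull m (is_derive_subf (dep x) (den x)).
  by rewrite (_ : m * _ = m ^+ 2 * (ep x + en x))//; ring.
- by rewrite ep0 en0 addrC.
- by rewrite ep0 en0 -[RHS]mulrN opprB.
- split; first by rewrite addr_gt0 ?expR_gt0.
  have epT : ep T = expR (m * T / 2) by congr expR; field.
  have enT : en T = expR (- (m * T / 2)) by congr expR; field.
  rewrite ep0 en0 epT enT /coth.
  have : 0 < expR (m * T / 2) + expR (- (m * T / 2)).
    by rewrite addr_gt0 ?expR_gt0.
  have : 0 < expR (m * T / 2) - expR (- (m * T / 2)).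
    by rewrite subr_gt0 ltr_expR gtrN// divr_gt0// mulr_gt0.
  move: (expR _) (expR _) => x y yx0 xy0.
  by field; rewrite !gt_eqF.
Qed.

Lemma sharp_lower_bound alpha beta lambda K : 0 < alpha -> 0 < beta ->
  0 < lambda -> interpolation_inequality alpha beta K ->
  K1_value beta lambda <= K.
Proof.
move=> al0 b0 l0 hK.
set T := 2 * pi / alpha in hK.
have T0 : 0 < T by rewrite divr_gt0// mulr_gt0// pi_gt0.
pose s := Num.sqrt (beta + lambda).
have s0 : 0 < s by rewrite sqrtr_gt0 addr_gt0.
have ms0 : 0 < alpha * s by rewrite mulr_gt0.
have [f [g [df dg f0T g0T [f0 gTE]]]] := sinh_cosh_pair ms0 T0.
have mT : alpha * s * T / 2 = pi * s by rewrite /T; field; rewrite gt_eqF.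
rewrite mT in gTE.
have cf := derivable_continuous_all df.
have cg := derivable_continuous_all dg.
have H1 := H1_per_per_ext T0 df cg f0T.
have mf : measurable_fun setT (per_ext T f) by case: H1 => -[].
have mg : measurable_fun setT (per_ext T g) by case: H1 => _ [].
have := hK _ _ H1; rewrite -/T.
rewrite (@Rintegral_eq_itvco T (fun x => per_ext T f x ^+ 2)
  (fun x => f x ^+ 2) T0); last 3 first.
- exact: measurable_realfun.measurable_funX.
- by move=> x; apply: cvgM; exact: cf.
- by move=> x xT; rewrite per_ext_id.
rewrite (@Rintegral_eq_itvco T
  (fun x => per_ext T g x ^+ 2 + alpha ^+ 2 * beta * per_ext T f x ^+ 2)
  (fun x => g x ^+ 2 + alpha ^+ 2 * beta * f x ^+ 2) T0); last 3 first.
- apply: measurable_realfun.measurable_funD.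
    exact: measurable_realfun.measurable_funX.
  apply: measurable_realfun.measurable_funM => //.
  exact: measurable_realfun.measurable_funX.
- move=> x; apply: cvgD; first by apply: cvgM; exact: cg.
  by apply: cvgM; [exact: cvg_cst|apply: cvgM; exact: cf].
- by move=> x xT; rewrite !per_ext_id.
set A := \int[mu]_(x in _) (_ + _); set B := \int[mu]_(x in _) _ => hsup.
(* The two boundary terms are equal, since [f] is even and [g] odd about [T / 2]. *)
have AB : A + alpha ^+ 2 * lambda * B = 2 * f 0 * g T.
  rewrite [LHS](@Rintegral_energy T _ _ f g T0 df).
    by rewrite f0T g0T; ring.
  move=> x; have := dg x; rewrite exprMn sqr_sqrtr ?addr_ge0 ?(ltW b0) ?(ltW l0)//.
  by rewrite mulrDr.
have A0 : 0 <= A.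
  apply: Rintegral_ge0 => x _.
  by rewrite addr_ge0 ?sqr_ge0// mulr_ge0 ?sqr_ge0// mulr_ge0 ?sqr_ge0// ltW.
have B0 : 0 <= B by apply: Rintegral_ge0 => x _; exact: sqr_ge0.
have {hsup}fK : f 0 ^+ 2 <= K * (Num.sqrt A * Num.sqrt B).
  have fs := @sup_norm_ge T f (per_ext T f) T0 cf (fun x => @per_ext_id T f x T0).
  rewrite -lee_fin EFin_expe mulrA; apply: le_trans hsup.
  by rewrite lee_sqr// ?(le_trans _ fs)// lee_fin ltW.
move: (A) (B) A0 B0 AB fK => {}A {}B A0 B0 AB fK.
have sl0 : 0 < Num.sqrt lambda by rewrite sqrtr_gt0.
pose h := Num.sqrt A * Num.sqrt B; rewrite -/h in fK.
have h0 : 0 <= h by rewrite mulr_ge0 ?sqrtr_ge0.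
(* The arithmetic-geometric mean inequality turns the weighted sum back into the product [h]. *)
have hle : 2 * (alpha * Num.sqrt lambda) * h <= 2 * f 0 * g T.
  rewrite -AB.
  have := sqr_ge0 (Num.sqrt A - alpha * Num.sqrt lambda * Num.sqrt B).
  rewrite sqrrB !exprMn !sqr_sqrtr ?(ltW l0)// /h; lra.
have c0 : 0 < coth (pi * s) by rewrite coth_gt0// mulr_gt0// pi_gt0.
(* Otherwise [fK] would force [f 0 ^+ 2 <= 0]; the sign is needed to multiply [hle] by [K]. *)
have K0 : 0 < K.
  rewrite ltNge; apply/negP => K0.
  have := le_trans fK (mulr_le0_ge0 K0 h0).
  by rewrite leNgt exprn_gt0.
rewrite /K1_value -/s -(ler_pM2l (exprn_gt0 2 f0)).
have := ler_wpM2l (ltW K0) hle; rewrite gTE => hh.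
have hf : f 0 ^+ 2 * (alpha * Num.sqrt lambda) <=
    K * f 0 ^+ 2 * (alpha * s) / coth (pi * s).
  have := ler_wpM2r (ltW (mulr_gt0 al0 sl0)) fK.
  move=> /le_trans; apply.
  rewrite (_ : K * f 0 ^+ 2 * (alpha * s) / coth (pi * s) =
    K * (2 * f 0 * (f 0 * (alpha * s) / coth (pi * s))) / 2); last first.
    by field; rewrite gt_eqF.
  by move: hh; set X := K * (2 * f 0 * _); lra.
have cs0 : 0 <= coth (pi * s) / (s * alpha).
  by apply: divr_ge0; [exact: ltW|exact/ltW/mulr_gt0].
have := ler_wpM2r cs0 hf.
rewrite (_ : f 0 ^+ 2 * (alpha * Num.sqrt lambda) * (coth (pi * s) / (s * alpha)) =
    f 0 ^+ 2 * (Num.sqrt lambda * (coth (pi * s) / s))); last first.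
  by field; rewrite !gt_eqF.
rewrite (_ : K * f 0 ^+ 2 * (alpha * s) / coth (pi * s) *
    (coth (pi * s) / (s * alpha)) = f 0 ^+ 2 * K)//.
by field; rewrite !gt_eqF.
Qed.

End sharpness.

(** * The numerical bound *)

Section numerics.
Context {R : realType}.
Implicit Types (x y z beta lambda : R).

Lemma sin_le_id z : 0 <= z -> sin z <= z.
Proof.
move=> z0; have d (y : R) : is_derive y 1 (fun y => y - sin y) (1 - cos y).
  exact: is_derive_subf (is_derive_id y 1) (is_derive_sin y).
rewrite -subr_ge0 -[leLHS](subrr 0) -{2}sin0.
by apply: (is_derive_ge0_le z0 d) => y _; rewrite subr_ge0 cos_le1.
Qed.

(** This is [cos y = 1 - 2 sin^2 (y / 2)] together with [sin z <= z]. *)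
Lemma cos_ge_taylor2 y : 0 <= y <= 1 -> 1 - y ^+ 2 / 2 <= cos y.
Proof.
move=> /andP[y0 y1].
have -> : y = (y / 2) *+ 2 by rewrite -mulr_natl; field.
rewrite cos_mulr2n cos2sin2.
have s1 : 0 <= sin (y / 2).
  by rewrite sin_ge0_pi//; have := pi_ge2 R; lra.
have s2 : sin (y / 2) <= y / 2 by apply: sin_le_id; lra.
rewrite -mulr_natl; nra.
Qed.

(* Doubling [cos y >= 1 - y^2 / 2] three times from [y = 0.195] gives
   [cos 1.56 > 0]. *)
Lemma pi_gt_312 : 78 / 25 < pi :> R.
Proof.
rewrite ltNge; apply/negP => hpi.
have [y yE] : exists y : R, y = 39 / 200 by exists (39 / 200).
(* Each rational is the previous bound carried through [2 c^2 - 1] and rounded down; about 0.005 is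
   left at the end. *)
have c0 : 103 / 105 <= cos y.
  have h : 1 - y ^+ 2 / 2 <= cos y by apply: cos_ge_taylor2; rewrite yE; lra.
  apply: le_trans h; rewrite yE; lra.
have c1 : 1849 / 2000 <= cos (y *+ 2) by rewrite cos_mulr2n; nra.
have c2 : 709 / 1000 <= cos (y *+ 2 *+ 2) by rewrite cos_mulr2n; nra.
have c3 : 0 < cos (y *+ 2 *+ 2 *+ 2) by rewrite cos_mulr2n; nra.
have y8E : y *+ 2 *+ 2 *+ 2 = 39 / 25 by rewrite !mulr2n yE; lra.
have : cos (y *+ 2 *+ 2 *+ 2) <= cos (pi / 2).
  have p2 := pi_ge2 R; rewrite y8E leNgt ltr_cos ?in_itv/=; first by lra.
  - by apply/andP; split; lra.
  - by apply/andP; split; lra.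
move: c3; move: (y *+ 2 *+ 2 *+ 2) => t; rewrite cos_pihalf => t0.
by rewrite leNgt t0.
Qed.

(** The difference has derivative [exp y + exp (- y) - 2 >= 0], because the two exponentials have
    product 1. *)
Lemma expR_sub_ge z : 0 <= z -> 2 * z <= expR z - expR (- z).
Proof.
move=> z0; pose F y := expR (1 * y) - expR (-1 * y) - 2 * y.
have d y : is_derive y 1 F (1 * expR (1 * y) - -1 * expR (-1 * y) - 2 * 1).
  exact: is_derive_subf (is_derive_subf (is_derive_expR_mul _ _)
    (is_derive_expR_mul _ _)) (is_derive_mull 2 (is_derive_id y 1)).
have : F 0 <= F z.
  apply: (is_derive_ge0_le z0 d) => y _.
  rewrite mul1r !mulN1r mul1r opprK mulr1.
  have := expRxMexpNx_1 y; have := expR_gt0 y; have := expR_gt0 (- y).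
  move: (expR _) (expR _) => a b a0 b0 ab.
  by have := sqr_ge0 (a - b); nra.
by rewrite /F !mulr0 mul1r mulN1r !subrr subr_ge0.
Qed.

Lemma expR_add_double z :
  expR (2 * z) + expR (- (2 * z)) = (expR z + expR (- z)) ^+ 2 - 2.
Proof.
have e1 : expR (2 * z) = expR z ^+ 2 by rewrite expRM_natl.
have e2 : expR (- (2 * z)) = expR (- z) ^+ 2 by rewrite -mulrN expRM_natl.
by rewrite e1 e2 sqrrD -mulr_natl expRxMexpNx_1; ring.
Qed.

(** This follows from [2 cosh y = 2 + 4 sinh^2 (y / 2)] and [sinh z >= z]. *)
Lemma expR_add_ge y : 0 <= y -> 2 + y ^+ 2 <= expR y + expR (- y).
Proof.
move=> y0; have -> : y = 2 * (y / 2) by field.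
rewrite expR_add_double.
have z0 : 0 <= y / 2 by rewrite divr_ge0.
have := expR_sub_ge z0; have := expRxMexpNx_1 (y / 2).
move: (y / 2) z0 => z z0; move: (expR z) (expR (- z)) => a b ab h.
have : (2 * z) ^+ 2 <= (a - b) ^+ 2 by rewrite ler_pXn2r// nnegrE; lra.
rewrite sqrrB sqrrD -mulr_natl -[_ *+ 2]mulr_natl ab; lra.
Qed.

(* The maximum of [x / cosh x] is [0.66274...] (Laplace limit), close to
   [x = 1.2], at which the quadratic minorants below are tangent. *)
Lemma le_expR_add x : 0 <= x ->
  x <= 167 / 250 * ((expR x + expR (- x)) / 2).
Proof.
move=> x0.
(* Two doublings from [x / 4] sharpen the quadratic bound enough for the constant 167 / 250. *)
have x4 : 0 <= x / 4 by rewrite divr_ge0.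
have h1 := expR_add_ge x4.
have h2 := expR_add_double (x / 4).
have h3 := expR_add_double (2 * (x / 4)).
rewrite (_ : 2 * (2 * (x / 4)) = x) in h3; last by field.
rewrite {}h3 {}h2.
move: (expR _ + expR _) h1 => c h1.
have sq : 2 + x ^+ 2 / 4 + x ^+ 4 / 256 <= c ^+ 2 - 2.
  have : (2 + (x / 4) ^+ 2) ^+ 2 <= c ^+ 2.
    rewrite ler_pXn2r// nnegrE ?addr_ge0 ?sqr_ge0//.
    by rewrite (le_trans _ h1)// addr_ge0 ?sqr_ge0.
  rewrite (_ : (2 + (x / 4) ^+ 2) ^+ 2 = 4 + x ^+ 2 / 4 + x ^+ 4 / 256); first lra.
  by field.
move: (c ^+ 2 - 2) sq => q sq {c h1 x4}.
have x4 : 72 / 25 * x ^+ 2 - 1296 / 625 <= x ^+ 4.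
  rewrite -subr_ge0 [leRHS](_ : _ = (x ^+ 2 - 36 / 25) ^+ 2) ?sqr_ge0//.
  by field.
have x2 : 46 / 19 * x - 529 / 361 <= x ^+ 2.
  rewrite -subr_ge0 [leRHS](_ : _ = (x - 23 / 19) ^+ 2) ?sqr_ge0//.
  by field.
(* [q] stands for [2 cosh (x / 2)], and 45 / 19 approximates its lower bound at [x = 6 / 5]. *)
have q2 : 90 / 19 * q - 2025 / 361 <= q ^+ 2.
  rewrite -subr_ge0 [leRHS](_ : _ = (q - 45 / 19) ^+ 2) ?sqr_ge0//.
  by field.
have r0 := sqr_ge0 x.
move: (x ^+ 2) (x ^+ 4) (q ^+ 2) r0 x2 x4 q2 sq => r w Q r0 x2 x4 q2 sq.
by lra.
Qed.

Lemma K1_value_le1 beta lambda : 17 / 370 <= beta -> 0 < lambda ->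
  K1_value beta lambda <= 1.
Proof.
move=> hb l0; have b0 : 0 < beta by lra.
rewrite /K1_value; set s := Num.sqrt (beta + lambda).
have s0 : 0 < s by rewrite sqrtr_gt0 addr_gt0.
have s2 : s ^+ 2 = beta + lambda by rewrite sqr_sqrtr// addr_ge0// ltW.
have p0 : 0 < pi :> R := pi_gt0 R.
have ps0 : 0 < pi * s by rewrite mulr_gt0.
rewrite mulrA ler_pdivrMr// mul1r.
rewrite -(ler_pXn2r (n := 2))// ?nnegrE ?(ltW s0)//; last first.
  by apply: mulr_ge0; [exact: sqrtr_ge0|exact/ltW/coth_gt0].
rewrite exprMn sqr_sqrtr ?(ltW l0)// /coth.
have := le_expR_add (ltW ps0); have := expRxMexpNx_1 (pi * s).
have : expR (- (pi * s)) < expR (pi * s) by rewrite ltr_expR gtrN.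
have := expR_gt0 (- (pi * s)); have := pi_gt_312.
move: (expR _) (expR _) => a b hpi b0' ba ab h.
(* The constant 3 / 14 exceeds [(167 / 250) / (78 / 25)], and its square 9 / 196 is below 17 /
   370. *)
have hs : s <= 3 / 14 * ((a + b) / 2).
  have : 78 / 25 * s <= 167 / 250 * ((a + b) / 2).
    by apply: le_trans h; rewrite ler_pM2r// ltW.
  lra.
have hs2 : s ^+ 2 <= beta * ((a + b) / 2) ^+ 2.
  apply: (@le_trans _ _ ((3 / 14 * ((a + b) / 2)) ^+ 2)).
    by rewrite ler_pXn2r// nnegrE ?(ltW s0)// (le_trans _ hs)// ltW.
  by rewrite exprMn ler_wpM2r ?sqr_ge0//; lra.
have ab0 : 0 < a - b by rewrite subr_gt0.
rewrite expr_div_n mulrA ler_pdivrMr ?exprn_gt0//.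
have -> : (a - b) ^+ 2 = (a + b) ^+ 2 - 4.
  by rewrite sqrrB sqrrD -mulr_natl -[_ *+ 2]mulr_natl ab; lra.
(* After this substitution the goal simplifies to [4 s^2 <= beta (a + b)^2], which is [hs2]. *)
have -> : lambda = s ^+ 2 - beta by rewrite s2; ring.
move: hs2; rewrite exprMn; nra.
Qed.

End numerics.

(** * The sharp constant as a supremum, and the range of [beta] where it is 1 *)

Theorem theorem2p1 (R : realType) :
  (forall alpha beta : R, 0 < alpha -> 0 < beta ->
     has_sup (K1_values beta) /\
     is_sharp_constant alpha beta (sup (K1_values beta))) /\
  (exists b : R, is_beta_star b) /\
  (forall beta_star : R, is_beta_star beta_star ->
     forall alpha beta : R, 0 < alpha -> beta_star <= beta ->
     is_sharp_constant alpha beta 1).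
Proof.
have sharp (alpha beta : R) : 0 < alpha -> 0 < beta ->
    is_sharp_constant alpha beta (sup (K1_values beta)).
  move=> a0 b0; split; first exact: interpolation_inequality_sup.
  move=> K hK; apply: sup_K1_values_le => lambda l0.
  exact: sharp_lower_bound hK.
split=> [alpha beta a0 b0|].
  by split; [exact: K1_values_has_sup|exact: sharp].
split=> [|b [/andP[b45 _] supb] alpha beta a0 bb].
  (* 17 / 370 = 0.0459... lies in the required window and is the threshold of [K1_value_le1]. *)
  exists (17 / 370); split; first by apply/andP; split; lra.
  apply/eqP; rewrite eq_le K1_values_sup_ge1 ?andbT; last by lra.
  by apply: sup_K1_values_le => lambda; exact: K1_value_le1.
have b0 : 0 < b by lra.
have beta0 : 0 < beta by rewrite (lt_le_trans b0).
suff <- : sup (K1_values beta) = 1 by exact: sharp.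
apply/eqP; rewrite eq_le K1_values_sup_ge1// andbT.
apply: sup_K1_values_le => lambda l0; rewrite -supb.
by apply: le_trans (K1_value_le_sup b0 l0); exact: K1_value_le (ltW b0) bb l0.
Qed.
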